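(* Assume all of the following. (1) For all $i=1,\dots,N$, the function $f_i:\mathbb{R}^{n_i}\to\mathbb{R}$ is convex and the set $X_i\subset\mathbb{R}^{n_i}$ is convex and compact. (2) The primal problem $(\mathcal{P})$ admits an optimal solution and the dual problem $(\mathcal{D})$ admits an optimal solution. (3) The graph $\mathcal{G}$ is undirected and connected, i.e., $(i,j)\in\mathcal{E}$ if and only if $(j,i)\in\mathcal{E}$, and every pair of vertices is joined by a path of edges in $\mathcal{E}$. (4) For all $i,j$: $w_{ij}\in[0,1)$ and $w_{ij}=w_{ji}$; $\sum_{i=1}^N w_{ij}=1$ for all $j$; $\sum_{j=1}^N w_{ij}=1$ for all $i$; and $w_{ij}>0$ if and only if $(i,j)\in\mathcal{E}$. (5) The matrix $\mathcal{W}=[w_{ij}]\in\mathbb{R}^{N\times N}$ is positive semidefinite. Then any sequences generated by the Tracking-ADMM algorithm are such that: (i) any limit point of the primal sequence $\{\boldsymbol{x}_k\}_{k\ge0}$ is an optimal solution of $(\mathcal{P})$; (ii) there is an optimal solution $\lambda^\star$ of $(\mathcal{D})$ such that, for every $i=1,\dots,N$, the dual sequence $\{\lambda_{i,k}\}_{k\ge0}$ converges to $\lambda^\star$ (the same $\lambda^\star$ for all $i$).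
   Context: Problem. Given $N$ agents, functions $f_i:\mathbb{R}^{n_i}\to\mathbb{R}$, sets $X_i\subset\mathbb{R}^{n_i}$, matrices $A_i\in\mathbb{R}^{p\times n_i}$ ($i=1,\dots,N$) and $b\in\mathbb{R}^p$, the primal problem is $$(\mathcal{P})\qquad \min_{x_1,\dots,x_N}\ \sum_{i=1}^N f_i(x_i)\quad\text{subject to}\quad \sum_{i=1}^N A_ix_i=b,\quad x_i\in X_i,\ i=1,\dots,N.$$ Let $b_1,\dots,b_N\in\mathbb{R}^p$ be any vectors with $\sum_{i=1}^N b_i=b$. The dual problem is $$(\mathcal{D})\qquad \max_{\lambda\in\mathbb{R}^p}\ \sum_{i=1}^N\varphi_i(\lambda),\qquad \varphi_i(\lambda)=\min_{x_i\in X_i} f_i(x_i)+\lambda^\top(A_ix_i-b_i).$$ Network. $\mathcal{G}=(\mathcal{V},\mathcal{E})$ is a graph with $\mathcal{V}=\{1,\dots,N\}$, $\mathcal{E}\subseteq\mathcal{V}\times\mathcal{V}$, $(i,i)\in\mathcal{E}$ for all $i$; $\mathcal{N}_i=\{j\in\mathcal{V}:(i,j)\in\mathcal{E}\}$. Each pair $(i,j)$ carries a weight $w_{ij}$, with $w_{ij}=0$ if $(i,j)\notin\mathcal{E}$. Tracking-ADMM algorithm, with constant penalty parameter $c>0$ (arbitrary). Initialization, for each $i$: $x_{i,0}\in X_i$ arbitrary, $d_{i,0}=A_ix_{i,0}-b_i$, $\lambda_{i,0}\in\mathbb{R}^p$ arbitrary. For $k=0,1,2,\dots$, each agent $i$ computes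 $$\delta_{i,k}=\sum_{j\in\mathcal{N}_i}w_{ij}d_{j,k},\qquad \ell_{i,k}=\sum_{j\in\mathcal{N}_i}w_{ij}\lambda_{j,k},$$ $$x_{i,k+1}\in\arg\min_{x_i\in X_i}\Big\{f_i(x_i)+\ell_{i,k}^\top A_ix_i+\frac c2\|A_ix_i-A_ix_{i,k}+\delta_{i,k}\|^2\Big\}\quad\text{(any minimizer)},$$ $$d_{i,k+1}=\delta_{i,k}+A_ix_{i,k+1}-A_ix_{i,k},\qquad \lambda_{i,k+1}=\ell_{i,k}+c\,d_{i,k+1}.$$ Notation. $\|\cdot\|$ is the Euclidean norm and $\boldsymbol{x}_k=[x_{1,k}^\top\cdots x_{N,k}^\top]^\top$. *)

(* Defs.v *)
From HB Require Import structures.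
From mathcomp Require Import all_boot all_order all_algebra.
From mathcomp Require Import all_classical all_reals all_analysis.

Set Implicit Arguments.
Unset Strict Implicit.
Unset Printing Implicit Defensive.

Import Order.TTheory GRing.Theory Num.Theory.
Import numFieldNormedType.Exports.
Local Open Scope classical_set_scope.
Local Open Scope ring_scope.

Definition dotv (R : realType) (m : nat) (u v : 'cV[R]_m) : R :=
  (u^T *m v) 0 0.

(* The library norm [`|v|] on matrices is the maximum norm, hence this
   separate Euclidean norm. The two induce the same topology, so convergence,
   compactness and cluster points below are those of the library. *)
Definition enorm (R : realType) (m : nat) (v : 'cV[R]_m) : R :=
  Num.sqrt (dotv v v).

Definition psdmx (R : realType) (m : nat) (W : 'M[R]_m) : Prop :=
  W^T = W /\ forall v : 'cV[R]_m, 0 <= dotv v (W *m v).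

Definition argmin (R : realType) (T : Type) (S : set T) (g : T -> R) : set T :=
  [set x | S x /\ forall y, S y -> g x <= g y].

Lemma inf_argmin (R : realType) (T : Type) (S : set T) (g : T -> R) (x : T) :
  argmin S g x -> inf (g @` S) = g x.
Proof.
move=> [Sx gx]; have lbx : lbound (g @` S) (g x) by move=> _ [y Sy <-]; exact: gx.
apply/eqP; rewrite eq_le; apply/andP; split.
  by apply: ge_inf; [exists (g x) | exists x].
by apply: lb_le_inf => //; exists (g x); exists x.
Qed.

Section Problem.
Variables (R : realType) (N p : nat) (n : 'I_N -> nat).
Variables (f : forall i, 'cV[R]_(n i) -> R) (X : forall i, set 'cV[R]_(n i)).
Variable A : forall i, 'M[R]_(p, n i).

Definition primal_obj (x : forall i, 'cV[R]_(n i)) : R := \sum_i f (x i).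

Definition primal_feasible (b : 'cV[R]_p) : set (forall i, 'cV[R]_(n i)) :=
  [set x | \sum_i A i *m x i = b /\ forall i, X (x i)].

Definition primal_optimal (b : 'cV[R]_p) : set (forall i, 'cV[R]_(n i)) :=
  argmin (primal_feasible b) primal_obj.

(* [inf] is total; it is the minimum whenever one is attained ([inf_argmin]),
   as is the case when [X i] is nonempty and compact and [f i] is convex on the
   whole space, hence continuous. *)
Definition dual_term (bs : 'I_N -> 'cV[R]_p) (i : 'I_N) (lam : 'cV[R]_p) : R :=
  inf [set f y + dotv lam (A i *m y - bs i) | y in X (i:=i)].

Definition dual_obj (bs : 'I_N -> 'cV[R]_p) (lam : 'cV[R]_p) : R :=
  \sum_i dual_term bs i lam.

Definition dual_optimal (bs : 'I_N -> 'cV[R]_p) : set 'cV[R]_p :=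
  [set lam | forall mu, dual_obj bs mu <= dual_obj bs lam].

(* [E i j] means that [j] is a neighbour of [i]. *)
Definition mix (E : rel 'I_N) (W : 'M[R]_N) (v : 'I_N -> 'cV[R]_p)
    (i : 'I_N) : 'cV[R]_p :=
  \sum_(j | E i j) W i j *: v j.

(* A relation, since the local minimizers need not be unique. *)
Record tracking_admm (bs : 'I_N -> 'cV[R]_p) (E : rel 'I_N) (W : 'M[R]_N)
    (c : R) (x : nat -> forall i, 'cV[R]_(n i))
    (d lam : nat -> 'I_N -> 'cV[R]_p) : Prop := TrackingADMM {
  admm_x0 : forall i, X (x 0%N i);
  admm_d0 : forall i, d 0%N i = A i *m x 0%N i - bs i;
  admm_xS : forall k i,
    argmin (X (i:=i))
      (fun y => f y + dotv (mix E W (lam k) i) (A i *m y)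
         + c / 2 * enorm (A i *m y - A i *m x k i + mix E W (d k) i) ^+ 2)
      (x k.+1 i);
  admm_dS : forall k i,
    d k.+1 i = mix E W (d k) i + A i *m x k.+1 i - A i *m x k i;
  admm_lamS : forall k i,
    lam k.+1 i = mix E W (lam k) i + c *: d k.+1 i
}.

End Problem.

(* Main.v *)
Require Import Defs.
From mathcomp Require Import all_boot all_order all_algebra.
From mathcomp Require Import all_classical all_reals all_analysis.
From mathcomp Require Import ring lra.
Import Order.TTheory GRing.Theory Num.Theory.
Import numFieldNormedType.Exports.
Local Open Scope classical_set_scope.
Local Open Scope ring_scope.

Set Implicit Arguments.
Unset Strict Implicit.
Unset Printing Implicit Defensive.

(* Stack the multiplier errors, divided by c, and the vectors A_i (x_i - xs_i)
   as the columns of matrices l and U, where (xs, mu) is a saddle point of the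
   Lagrangian. The optimality conditions of the local minimisations give
   <l, U> <= 0 at every step. The tracking recursion can be rewritten
   as m' = m - l (1 - W), l' = l W^2 + r', U' = r' - m' (1 - W), with an
   auxiliary state m orthogonal to consensus, and the energy
     |l|^2 + |m|^2 - 2 <l, m (1 - W)> = |m'|^2 + 2 <l, l W> - |l W|^2
   is nonnegative since 0 <= W <= 1. It decreases by at least
     |r'|^2 + 2 <l, l W> - |l W|^2 - |l W^2|^2,
   so l is bounded, r and l W (1 - W) vanish asymptotically, the multipliers
   reach consensus and the coupling constraint holds in the limit. Hence limit
   points of x are optimal. A joint limit point of the primal and dual sequences
   is again a saddle point; with it as reference the energy tends to 0 along
   a subsequence, hence along the whole sequence. *)

(** * Entrywise limits of matrices along a filter *)

Section MatrixLimits.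
Variables (R : realType) (T : Type) (F : set_system T).
Context {FF : Filter F}.

Lemma cvg_mx (m n : nat) (M : T -> 'M[R]_(m, n)) (L : 'M[R]_(m, n)) :
  (forall i j, (fun t => M t i j) @ F --> L i j) -> M @ F --> L.
Proof.
move=> ML B [P LP PB].
have : \forall t \near F, forall i j, P i j (M t i j).
  by apply: filter_forall => i; apply: filter_forall => j; exact: (ML i j _ (LP i j)).
by apply: filterS => t Pt; exact: PB.
Qed.

Lemma cvg_coord (m n : nat) (M : T -> 'M[R]_(m, n)) (L : 'M[R]_(m, n)) i j :
  M @ F --> L -> (fun t => M t i j) @ F --> L i j.
Proof.
move=> ML.
exact: (cvg_comp _ (fun N : 'M[R]_(m, n) => N i j) ML (@coord_continuous _ _ _ i j L)).
Qed.

Lemma cvg_sumr (I : Type) (r : seq I) (P : pred I) (g : I -> T -> R) (l : I -> R) :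
  (forall i, P i -> g i @ F --> l i) ->
  (fun t => \sum_(i <- r | P i) g i t) @ F --> \sum_(i <- r | P i) l i.
Proof. by move=> gl; apply: cvg_big => //; exact: add_continuous. Qed.

Lemma cvg_sumr0 (I : Type) (r : seq I) (P : pred I) (g : I -> T -> R) :
  (forall i, P i -> g i @ F --> (0 : R)) ->
  (fun t => \sum_(i <- r | P i) g i t) @ F --> (0 : R).
Proof. by move=> /(@cvg_sumr _ r P g (fun=> 0)); rewrite big1. Qed.

Lemma cvg_sum_mx (I : finType) (m n : nat) (M : I -> T -> 'M[R]_(m, n))
    (L : I -> 'M[R]_(m, n)) :
  (forall i, M i @ F --> L i) -> (fun t => \sum_i M i t) @ F --> \sum_i L i.
Proof. by move=> ML; apply: cvg_big => //; exact: add_continuous. Qed.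

Lemma cvg_mulmx (m n q : nat) (A : T -> 'M[R]_(m, n)) (B : T -> 'M[R]_(n, q))
    (a : 'M[R]_(m, n)) (b : 'M[R]_(n, q)) :
  A @ F --> a -> B @ F --> b -> (fun t => A t *m B t) @ F --> a *m b.
Proof.
move=> Aa Bb; apply: cvg_mx => i j; rewrite mxE.
under eq_fun do rewrite mxE.
by apply: cvg_sumr => k _; apply: cvgM; exact: cvg_coord.
Qed.

End MatrixLimits.

(** * The Frobenius inner product and limits controlled by it *)

Section Frobenius.
Variable R : realType.

Definition fdot (m n : nat) (A B : 'M[R]_(m, n)) : R := \tr (A^T *m B).

Section FixedSize.
Variables m n : nat.
Implicit Types A B C : 'M[R]_(m, n).

Lemma fdotE A B : fdot A B = \sum_j \sum_i A i j * B i j.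
Proof. by apply: eq_bigr => j _; rewrite mxE; apply: eq_bigr => i _; rewrite mxE. Qed.

Lemma fdotC A B : fdot A B = fdot B A.
Proof. by rewrite !fdotE; do 2!apply: eq_bigr => ? _; rewrite mulrC. Qed.

Lemma fdotDl A B C : fdot (A + B) C = fdot A C + fdot B C.
Proof. by rewrite /fdot raddfD mulmxDl raddfD. Qed.

Lemma fdotDr A B C : fdot A (B + C) = fdot A B + fdot A C.
Proof. by rewrite /fdot mulmxDr raddfD. Qed.

Lemma fdotBl A B C : fdot (A - B) C = fdot A C - fdot B C.
Proof. by rewrite /fdot raddfB mulmxBl raddfB. Qed.

Lemma fdotBr A B C : fdot A (B - C) = fdot A B - fdot A C.
Proof. by rewrite /fdot mulmxBr raddfB. Qed.

Lemma fdotZl a A B : fdot (a *: A) B = a * fdot A B.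
Proof. by rewrite /fdot linearZ -scalemxAl linearZ. Qed.

Lemma fdot_ge0 A : 0 <= fdot A A.
Proof. by rewrite fdotE; do 2!apply: sumr_ge0 => ? _; rewrite -expr2 sqr_ge0. Qed.

Lemma fdot_coord A i j : A i j ^+ 2 <= fdot A A.
Proof.
rewrite fdotE (bigD1 j) //= (bigD1 i) //= -expr2 -addrA lerDl addr_ge0 //.
  by apply: sumr_ge0 => k _; rewrite -expr2 sqr_ge0.
by do 2!apply: sumr_ge0 => ? _; rewrite -expr2 sqr_ge0.
Qed.

Lemma fdot_symr (W : 'M[R]_n) A B : W^T = W -> fdot (A *m W) B = fdot A (B *m W).
Proof. by move=> WT; rewrite /fdot trmx_mul WT -mulmxA mxtrace_mulC mulmxA. Qed.

(** A crude substitute for Cauchy-Schwarz: each entry [a] of [A] satisfies [|a| <= 1 + a ^+ 2], and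
    [a ^+ 2] is at most [fdot A A]. It suffices to pair a bounded family with a vanishing one. *)
Lemma normr_fdot_le A B : `|fdot A B| <= (1 + fdot A A) * \sum_j \sum_i `|B i j|.
Proof.
rewrite {1}fdotE mulr_sumr; apply: (le_trans (ler_norm_sum _ _ _)).
apply: ler_sum => j _; rewrite mulr_sumr; apply: (le_trans (ler_norm_sum _ _ _)).
apply: ler_sum => i _; rewrite normrM ler_wpM2r //.
have := fdot_coord A i j; rewrite -real_normK ?num_real // => h.
have := sqr_ge0 (`|A i j| - 1); have := normr_ge0 (A i j); nra.
Qed.

Section Limits.
Variables (T : Type) (F : set_system T).
Context {FF : Filter F}.
Implicit Types (u v : T -> 'M[R]_(m, n)).

Lemma cvg_fdot u v A B :
  u @ F --> A -> v @ F --> B -> (fun t => fdot (u t) (v t)) @ F --> fdot A B.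
Proof.
move=> uA vB; rewrite fdotE; under eq_fun do rewrite fdotE.
by do 2!(apply: cvg_sumr => ? _); apply: cvgM; exact: cvg_coord.
Qed.

Lemma cvg_fdot0 u :
  (fun t => fdot (u t) (u t)) @ F --> (0 : R) -> u @ F --> (0 : 'M[R]_(m, n)).
Proof.
move=> u0; apply: cvg_mx => i j; rewrite mxE.
apply/cvgrPdist_lt => e e0; near=> t.
rewrite sub0r normrN -(@ltr_pXn2r _ 2) ?nnegrE ?normr_ge0 ?ltW //.
rewrite real_normK ?num_real //; apply: (le_lt_trans (fdot_coord _ _ _)).
by near: t; apply: (cvgr_lt _ u0); rewrite exprn_gt0.
Unshelve. all: by end_near. Qed.

Lemma cvg_fdot_bounded u v (M : R) :
  (forall t, fdot (u t) (u t) <= M) -> v @ F --> (0 : 'M[R]_(m, n)) ->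
  (fun t => fdot (u t) (v t)) @ F --> (0 : R).
Proof.
move=> uM v0; have s0 : (fun t => \sum_j \sum_i `|v t i j|) @ F --> (0 : R).
  apply: cvg_sumr0 => j _; apply: cvg_sumr0 => i _.
  have /cvg_norm : (fun t => v t i j) @ F --> (0 : 'M[R]_(m, n)) i j.
    exact: cvg_coord.
  by rewrite mxE normr0.
apply: norm_cvg0.
apply: (@squeeze_cvgr _ _ _ _ (fun=> 0) (fun t => (1 + M) * \sum_j \sum_i `|v t i j|)).
- near=> t; rewrite normr_ge0 (le_trans (normr_fdot_le _ _)) // ler_wpM2r ?lerD2l //.
  by do 2!apply: sumr_ge0 => ? _.
- exact: cvg_cst.
- by rewrite -[X in _ --> X](mulr0 (1 + M)); apply: cvgMl_tmp.
Unshelve. all: by end_near. Qed.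

End Limits.
End FixedSize.
End Frobenius.

(** * Energy identity and dissipation for 0 <= W <= 1 *)

Section Energy.
Variables (R : realType) (p N : nat) (W : 'M[R]_N).
Hypothesis WT : W^T = W.
Implicit Types l m r V : 'M[R]_(p, N).

Definition energy l m := fdot l l + fdot m m - 2 * fdot l (m - m *m W).

Lemma energyE l m :
  energy l m = fdot (m - (l - l *m W)) (m - (l - l *m W))
    + 2 * fdot l (l *m W) - fdot (l *m W) (l *m W).
Proof.
rewrite /energy !(fdotBl, fdotBr) (fdotC m l) (fdotC m (l *m W)).
by rewrite !(fdot_symr _ _ WT); ring.
Qed.

(** By [energyE] the squares of [m'] cancel, and what remains is the square of
    [l' - r = l *m W *m W]. In a run [r - (m' - m' *m W)] is the new [U], so the last term is
    nonpositive by monotonicity. *)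
Lemma energy_step l m r (m' := m - (l - l *m W)) (l' := l *m W *m W + r) :
  energy l' m' + fdot r r
    + (2 * fdot l (l *m W) - fdot (l *m W) (l *m W)
       - fdot (l *m W *m W) (l *m W *m W))
  = energy l m + 2 * fdot l' (r - (m' - m' *m W)).
Proof.
rewrite [energy l m]energyE -/m' /energy (fdotBr l' r).
rewrite /l' !fdotDl !fdotDr (fdotC r (l *m W *m W)); ring.
Qed.

Hypothesis W0 : forall V : 'M[R]_(p, N), 0 <= fdot V (V *m W).
Hypothesis W1 : forall V : 'M[R]_(p, N), fdot V (V *m W) <= fdot V V.

Lemma fdot_contract V : fdot (V *m W) (V *m W) <= fdot V (V *m W).
Proof.
(* W - W^2 = W (1 - W) W + (1 - W) W (1 - W) *)
have := W0 (V - V *m W); have := W1 (V *m W).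
rewrite mulmxBl !(fdotBl, fdotBr) !(fdot_symr _ _ WT); lra.
Qed.

Lemma energy_ge l m :
  fdot (m - (l - l *m W)) (m - (l - l *m W)) + fdot (l *m W) (l *m W) <= energy l m.
Proof. by rewrite energyE; have := fdot_contract l; lra. Qed.

Lemma fdot_contract2 V :
  fdot (V *m W *m W) (V *m W *m W) <= fdot (V *m W) (V *m W).
Proof. exact: le_trans (fdot_contract _) (W1 _). Qed.

(** Right minus left is twice the sum of the gaps in [fdot_contract] at [V] and at [V *m W]. Thus
    the energy loss controls the disagreement left after mixing. *)
Lemma fdot_disagreement_le V :
  fdot (V *m W - V *m W *m W) (V *m W - V *m W *m W)
    <= 2 * fdot V (V *m W) - fdot (V *m W) (V *m W)
       - fdot (V *m W *m W) (V *m W *m W).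
Proof.
have := fdot_contract V; have := fdot_contract (V *m W).
rewrite !(fdotBl, fdotBr) (fdotC (V *m W *m W) (V *m W)); lra.
Qed.

End Energy.

(** * Averaging over a connected graph with symmetric stochastic weights *)

Section Averaging.
Variables (R : realType) (N : nat) (E : rel 'I_N) (W : 'M[R]_N).
Hypothesis WT : W^T = W.
Hypothesis W_ge0 : forall i j, 0 <= W i j.
Hypothesis W_row : forall i, \sum_j W i j = 1.
Hypothesis W_gt0 : forall i j, E i j -> 0 < W i j.
Hypothesis E_connected : forall i j, connect E i j.

Definition avg_mx : 'M[R]_N := const_mx N%:R^-1.

(** The Dirichlet form of the graph, each row of [V] being a scalar signal on the vertices. After
    expanding the squares, unit row and column sums collapse each family of pure squares to
    [fdot V V]. *)
Lemma laplacian_sum (m : nat) (V : 'M[R]_(m, N)) :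
  2 * (fdot V V - fdot V (V *m W))
    = \sum_a \sum_i \sum_j W i j * (V a i - V a j) ^+ 2.
Proof.
have WC i j : W i j = W j i by rewrite -{1}WT mxE.
have -> : fdot V V = \sum_a \sum_i V a i ^+ 2.
  by rewrite fdotE exchange_big; do 2!apply: eq_bigr => ? _; rewrite expr2.
have -> : fdot V (V *m W) = \sum_a \sum_i \sum_j W i j * (V a i * V a j).
  rewrite fdotE exchange_big; apply: eq_bigr => a _; apply: eq_bigr => i _.
  rewrite mxE mulr_sumr; apply: eq_bigr => j _; rewrite (WC i j); ring.
rewrite -sumrB mulr_sumr; apply: eq_bigr => a _.
have row_sq : \sum_i \sum_j W i j * V a i ^+ 2 = \sum_i V a i ^+ 2.
  by apply: eq_bigr => i _; rewrite -mulr_suml W_row mul1r.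
have col_sq : \sum_i \sum_j W i j * V a j ^+ 2 = \sum_i V a i ^+ 2.
  rewrite exchange_big -row_sq; do 2!apply: eq_bigr => ? _; by rewrite WC.
rewrite mulrBr mulr_sumr.
rewrite (_ : \sum_i \sum_j W i j * (V a i - V a j) ^+ 2 =
  (\sum_i \sum_j W i j * V a i ^+ 2) + (\sum_i \sum_j W i j * V a j ^+ 2)
  - 2 * \sum_i \sum_j W i j * (V a i * V a j)); last first.
  rewrite mulr_sumr -big_split -sumrB; apply: eq_bigr => i _ /=.
  rewrite mulr_sumr -big_split -sumrB; apply: eq_bigr => j _ /=; ring.
rewrite row_sq col_sq -mulr_sumr; ring.
Qed.

Lemma fdot_mix_le (m : nat) (V : 'M[R]_(m, N)) : fdot V (V *m W) <= fdot V V.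
Proof.
rewrite -subr_ge0 -(pmulr_rge0 _ (@ltr0Sn R 1)) laplacian_sum.
by do 3!apply: sumr_ge0 => ? _; rewrite mulr_ge0 ?sqr_ge0.
Qed.

(** A fixed point has zero Dirichlet form, so it agrees across every edge, and a path carries the
    agreement from [i] to [j]. *)
Lemma consensus_of_fixed (m : nat) (V : 'M[R]_(m, N)) a i j :
  V *m W = V -> V a i = V a j.
Proof.
move=> VW; have := laplacian_sum V; rewrite VW subrr mulr0 => /esym/eqP.
rewrite psumr_eq0; last first.
  by move=> ? _; do 2!apply: sumr_ge0 => ? _; rewrite mulr_ge0 ?sqr_ge0.
move=> /allP/(_ a (mem_index_enum _))/=.
rewrite psumr_eq0; last first.
  by move=> ? _; apply: sumr_ge0 => ? _; rewrite mulr_ge0 ?sqr_ge0.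
move=> /allP Va.
have Eeq k l : E k l -> V a k = V a l.
  move=> Ekl; have := Va k (mem_index_enum _) => /=.
  rewrite psumr_eq0; last by move=> ? _; rewrite mulr_ge0 ?sqr_ge0.
  move=> /allP/(_ l (mem_index_enum _))/=.
  by rewrite mulf_eq0 gt_eqF ?W_gt0 //= sqrf_eq0 subr_eq0 => /eqP.
have /connectP[s] := E_connected i j.
elim: s i => [|k s IHs] i /=; first by move=> _ ->.
by move=> /andP[/Eeq ->]; exact: IHs.
Qed.

Lemma avg_mxE (m : nat) (C : 'M[R]_(N, m)) :
  (forall i j a, C i a = C j a) -> avg_mx *m C = C.
Proof.
move=> Cc; apply/matrixP => i a; rewrite mxE.
under eq_bigr => k _ do rewrite mxE (Cc k i).
rewrite sumr_const card_ord -mulrnAl -mulr_natr mulVf ?mul1r // pnatr_eq0.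
by case: N i {Cc} C => [[]|].
Qed.

Lemma trmx_avg : avg_mx^T = avg_mx.
Proof. by apply/matrixP => i j; rewrite !mxE. Qed.

Lemma avg_mixl : W *m avg_mx = avg_mx.
Proof.
by apply/matrixP => i j; rewrite mxE; under eq_bigr do rewrite mxE;
   rewrite -mulr_suml W_row mul1r mxE.
Qed.

Lemma avg_mixr : avg_mx *m W = avg_mx.
Proof. by apply: trmx_inj; rewrite trmx_mul WT trmx_avg avg_mixl. Qed.

Lemma avg_idem : avg_mx *m avg_mx = avg_mx.
Proof. by apply: avg_mxE => i j a; rewrite !mxE. Qed.

(* By connectedness the kernel of [1 - W] consists of the constants. *)
Lemma laplacian_pinv :
  exists2 D : 'M[R]_N, D *m (1%:M - W) = 1%:M - avg_mx
                     & (1%:M - W) *m D^T = 1%:M - avg_mx.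
Proof.
have : (1%:M - avg_mx <= 1%:M - W)%MS.
  rewrite submxE mulmxBl mul1mx avg_mxE ?subrr // => i j a.
  (* The columns of the cokernel are fixed by [W], hence constant, and [1 - avg_mx] kills them; this
     gives the inclusion of row spaces. *)
  set C := cokermx _; have CW : C^T *m W = C^T.
    apply/eqP; rewrite eq_sym -subr_eq0 -{1}[C^T]mulmx1 -mulmxBr.
    by rewrite -trmx_eq0 trmx_mul trmxK linearB /= trmx1 WT mulmx_coker.
  by have := consensus_of_fixed a i j CW; rewrite !mxE.
case/submxP => D DE; exists D => //.
have symB (S : 'M[R]_N) : S^T = S -> (1%:M - S)^T = 1%:M - S.
  by move=> ST; rewrite linearB /= trmx1 ST.
by apply: trmx_inj; rewrite trmx_mul trmxK !symB ?trmx_avg.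
Qed.

End Averaging.

(** * The tracking recursion: change of state and energy argument *)

Section Dynamics.
Variables (R : realType) (p N : nat) (E : rel 'I_N) (W : 'M[R]_N).
Hypothesis WT : W^T = W.
Hypothesis W_ge0 : forall i j, 0 <= W i j.
Hypothesis W_row : forall i, \sum_j W i j = 1.
Hypothesis W_gt0 : forall i j, E i j -> 0 < W i j.
Hypothesis E_connected : forall i j, connect E i j.
Hypothesis W_psd : forall V : 'M[R]_(p, N), 0 <= fdot V (V *m W).

Variables U l D : nat -> 'M[R]_(p, N).
Hypothesis D_step : forall k, D k.+1 = D k *m W + U k.+1 - U k.
Hypothesis l_step : forall k, l k.+1 = l k *m W + D k.+1.
Hypothesis D_avg : D 0%N *m avg_mx R N = U 0%N *m avg_mx R N.
Hypothesis monotone : forall k, fdot (l k.+1) (U k.+1) <= 0.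

Let residual (m : nat -> 'M[R]_(p, N)) k := U k + (m k - m k *m W).

(* [U k.+1 - D k.+1] averages to 0, hence lies in the range of [1 - W]: this
   provides the initial value of the auxiliary state. *)
Lemma storage_state : exists m : nat -> 'M[R]_(p, N), [/\
  forall k, m k.+1 = m k - (l k - l k *m W),
  forall k, l k.+1 = l k *m W *m W + residual m k.+1 &
  forall k, m k *m avg_mx R N = 0].
Proof.
have [B BW _] := laplacian_pinv WT W_ge0 W_row W_gt0 E_connected.
have Wavg := avg_mixl W_row.
(* [Y] is the value that [m0 - m0 *m W] must have for the invariant [DU] below to hold at
   [k = 0]. *)
pose Y := D 0%N *m W - U 0%N + (l 0%N - l 0%N *m W).
have Yavg : Y *m avg_mx R N = 0.
  by rewrite mulmxDl !mulmxBl -!mulmxA !Wavg D_avg !subrr addr0.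
(* The last factor makes [m0] orthogonal to consensus and leaves [m0 - m0 *m W] unchanged, since
   [1 - W] absorbs it. *)
pose m0 := Y *m B *m (1%:M - avg_mx R N).
have m0avg : m0 *m avg_mx R N = 0.
  by rewrite -mulmxA mulmxBl mul1mx avg_idem subrr mulmx0.
have m0E : m0 - m0 *m W = Y.
  rewrite -{1}[m0]mulmx1 -mulmxBr -mulmxA.
  have -> : (1%:M - avg_mx R N) *m (1%:M - W) = 1%:M - W.
    by rewrite mulmxBl mul1mx mulmxBr mulmx1 (avg_mixr WT W_row) subrr subr0.
  by rewrite -mulmxA BW mulmxBr mulmx1 Yavg subr0.
pose m k := m0 - \sum_(j < k) (l j - l j *m W).
have mS k : m k.+1 = m k - (l k - l k *m W).
  by rewrite /m big_ord_recr /= opprD addrA.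
have DU k : D k.+1 - U k.+1 = (m k - l k) - (m k - l k) *m W.
  elim: k => [|k IHk].
    rewrite D_step /m big_ord0 subr0 mulmxBl.
    have -> : m0 - l 0%N - (m0 *m W - l 0%N *m W)
      = (m0 - m0 *m W) - (l 0%N - l 0%N *m W).
      by rewrite !opprD !opprK !addrA; congr (_ + _); rewrite addrAC.
    by rewrite m0E /Y addrK addrAC addrK.
  have -> : D k.+2 - U k.+2 = (D k.+1 - U k.+1) - (D k.+1 - D k.+1 *m W).
    rewrite [D k.+2]D_step; apply/matrixP => i j.
    move: (D k.+1 *m W) => X; rewrite !mxE; ring.
  rewrite IHk mS (_ : D k.+1 = l k.+1 - l k *m W); last first.
    by rewrite l_step addrAC subrr add0r.
  rewrite !mulmxBl; apply/matrixP => i j.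
  move: (l k *m W) (l k.+1 *m W) (m k *m W) => X1 X2 X3.
  move: (X1 *m W) => X4; rewrite !mxE; ring.
exists m; split=> // [k|k].
  rewrite l_step /residual; move/eqP: (DU k); rewrite subr_eq => /eqP ->.
  rewrite mS !mulmxBl; apply/matrixP => i j.
  move: (l k *m W) (m k *m W) => X1 X2.
  move: (X1 *m W) => X3; rewrite !mxE; ring.
rewrite mulmxBl m0avg sub0r mulmx_suml big1 ?oppr0 // => j _.
by rewrite mulmxBl -mulmxA Wavg subrr.
Qed.

Lemma cvg_of_shift (u : nat -> 'M[R]_(p, N)) (L : 'M[R]_(p, N)) :
  (fun k => u k.+1) @ \oo --> L -> u @ \oo --> L.
Proof. by move=> uL; rewrite -cvg_shiftS. Qed.

Lemma cvg_mulmxr0 (T : Type) (F : set_system T) (FF : Filter F) q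
    (u : T -> 'M[R]_(p, N)) (B : 'M[R]_(N, q)) :
  u @ F --> (0 : 'M[R]_(p, N)) -> (fun t => u t *m B) @ F --> (0 : 'M[R]_(p, q)).
Proof. by move=> u0; rewrite -[X in _ --> X](mul0mx _ B); apply: cvg_mulmx u0 (cvg_cst _). Qed.

(** The energy is nonincreasing and nonnegative, so its decrements vanish, and with them [r] and
    [q]. Subsequences are encoded as proper filters finer than [\oo]; the last clause upgrades
    convergence along one of them to the whole sequence. *)
Lemma tracking_convergence :
  [/\ exists M, forall k, fdot (l k) (l k) <= M,
      (fun k => l k *m (1%:M - avg_mx R N)) @ \oo --> (0 : 'M[R]_(p, N)),
      (fun k => U k *m avg_mx R N) @ \oo --> (0 : 'M[R]_(p, N)) &
      forall F : set_system nat, ProperFilter F -> F --> \oo ->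
        U @ F --> (0 : 'M[R]_(p, N)) -> l @ F --> (0 : 'M[R]_(p, N)) ->
        l @ \oo --> (0 : 'M[R]_(p, N))].
Proof.
have [m [mS lS mavg]] := storage_state.
have [B _ WB] := laplacian_pinv WT W_ge0 W_row W_gt0 E_connected.
have W_le := fdot_mix_le (m := p) WT W_ge0 W_row.
have Wavg := avg_mixl W_row.
pose r := residual m; pose e k := energy W (l k) (m k).
have e_ge k : fdot (l k *m W) (l k *m W) <= e k.
  by apply: le_trans (energy_ge WT W_psd W_le _ _); rewrite lerDr fdot_ge0.
have e_ge0 k : 0 <= e k := le_trans (fdot_ge0 _) (e_ge k).
pose q k := l k *m W - l k *m W *m W.
have e_step k : fdot (r k.+1) (r k.+1) + fdot (q k) (q k) <= e k - e k.+1.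
  have /= := energy_step WT (l k) (m k) (r k.+1); rewrite -lS -mS.
  have -> : r k.+1 - (m k.+1 - m k.+1 *m W) = U k.+1 by rewrite /r /residual addrK.
  have := monotone k; have := fdot_disagreement_le WT W_psd W_le (l k).
  rewrite -/(e k) -/(e k.+1) -/(q k); lra.
have e_S k : e k.+1 <= e k.
  have := e_step k; have := fdot_ge0 (r k.+1); have := fdot_ge0 (q k); lra.
have e_noninc : {homo e : i j / (i <= j)%N >-> j <= i}.
  by apply: homo_leq => // x y z yx zy; exact: le_trans zy yx.
have e_cvg : e @ \oo --> lim (e @ \oo).
  by apply: nonincreasing_is_cvgn => //; exists 0 => _ [k _ <-].
have de0 : (fun k => e k - e k.+1) @ \oo --> (0 : R).
  rewrite -(subrr (lim (e @ \oo))); apply: cvgB => //.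
  by have := e_cvg; rewrite -cvg_shiftS.
have r0 : r @ \oo --> (0 : 'M[R]_(p, N)).
  apply: cvg_of_shift; apply: cvg_fdot0.
  apply: (squeeze_cvgr _ (cvg_cst 0) de0); near=> k.
  rewrite fdot_ge0 /=; have := e_step k; have := fdot_ge0 (q k); lra.
have q0 : q @ \oo --> (0 : 'M[R]_(p, N)).
  apply: cvg_fdot0; apply: (squeeze_cvgr _ (cvg_cst 0) de0); near=> k.
  rewrite fdot_ge0 /=; have := e_step k; have := fdot_ge0 (r k.+1); lra.
split.
(* Both terms of [l k.+1 = l k *m W *m W + r k.+1] have squared norm at most [e 0%N], hence the
   factor 4; the first summand covers [l 0%N]. *)
- exists (fdot (l 0%N) (l 0%N) + 4 * e 0%N) => -[|k].
    by rewrite lerDl mulr_ge0.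
  have := fdot_ge0 (l k *m W *m W - r k.+1).
  have := fdot_contract2 WT W_psd W_le (l k).
  have := e_ge k; have := e_noninc 0%N k isT; have := e_step k; have := e_ge0 k.+1.
  have := fdot_ge0 (q k); have := fdot_ge0 (l 0%N).
  rewrite lS -/(r k.+1); move: (r k.+1) (q k) => rk qk.
  rewrite !(fdotBl, fdotBr, fdotDl, fdotDr) (fdotC rk (l k *m W *m W)); lra.
(* By the recursion, [l k.+1] times [1 - W] is [q k *m W] plus [r k.+1] times [1 - W], which
   vanishes; the pseudo-inverse then replaces [1 - W] by [1 - avg_mx]. *)
- have lW0 : (fun k => l k *m (1%:M - W)) @ \oo --> (0 : 'M[R]_(p, N)).
    apply: cvg_of_shift.
    rewrite (_ : (fun k => _) = fun k => q k *m W + r k.+1 *m (1%:M - W)).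
      rewrite -[X in _ --> X]addr0; apply: cvgD; first exact: cvg_mulmxr0.
      apply: (@cvg_mulmxr0 _ _ _ _ (fun k => r k.+1)).
      by have := r0; rewrite -cvg_shiftS.
    apply/funext => k; rewrite lS -/(r k.+1) mulmxDl; congr (_ + _).
    by rewrite /q mulmxBr mulmx1 mulmxBl.
  rewrite -WB; under eq_fun do rewrite mulmxA.
  exact: cvg_mulmxr0.
- rewrite (_ : (fun k => _) = fun k => r k *m avg_mx R N); first exact: cvg_mulmxr0.
  apply/funext => k; rewrite /r /residual mulmxDl mulmxBl -(mulmxA (m k)) Wavg.
  by rewrite subrr addr0.
move=> F FF Foo UF lF.
have Fsub (V : topologicalType) (u : nat -> V) (a : V) : u @ \oo --> a -> u @ F --> a.
  by apply: cvg_trans; exact: cvg_app.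
(* Since [m] is orthogonal to consensus, the pseudo-inverse recovers it from [r - U], and both [r]
   and [U] vanish along [F]. *)
have mF : m @ F --> (0 : 'M[R]_(p, N)).
  have mE k : m k = (r k - U k) *m B^T.
    rewrite /r /residual addrAC subrr add0r.
    have -> : m k - m k *m W = m k *m (1%:M - W) by rewrite mulmxBr mulmx1.
    by rewrite -mulmxA WB mulmxBr mavg mulmx1 subr0.
  rewrite (funext mE); apply: cvg_mulmxr0.
  by rewrite -(subrr 0); apply: cvgB => //; exact: Fsub.
have eF : e @ F --> (0 : R).
  have -> : (0 : R) = energy W (0 : 'M[R]_(p, N)) 0.
    by rewrite /energy mul0mx subrr /fdot !mulmx0 linear0 mulr0 addr0 subr0.
  rewrite /e /energy; apply: cvgB; first by apply: cvgD; exact: cvg_fdot.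
  have mWF : (fun k => m k - m k *m W) @ F --> (0 - 0 *m W : 'M[R]_(p, N)).
    exact: (cvgB mF (cvg_mulmx mF (cvg_cst W))).
  exact: (cvgMl_tmp (cvg_fdot lF mWF)).
(* The energy converges along [\oo], so its limit can be read off along [F]. It dominates the square
   of [l *m W], and one more step of the recursion gives [l]. *)
have e0 : e @ \oo --> (0 : R).
  by rewrite -(cvg_unique _ (Fsub _ _ _ e_cvg) eF).
have lW0 : (fun k => l k *m W) @ \oo --> (0 : 'M[R]_(p, N)).
  apply: cvg_fdot0; apply: (squeeze_cvgr _ (cvg_cst 0) e0); near=> k.
  by rewrite fdot_ge0 e_ge.
apply: cvg_of_shift; rewrite (funext lS) -[X in _ --> X]addr0; apply: cvgD.
  exact: cvg_mulmxr0.
by have := r0; rewrite -cvg_shiftS.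
Unshelve. all: by end_near. Qed.

End Dynamics.

(** * Convex functions on the whole space: Jensen and continuity *)

Section Convexity.
Variables (R : realType) (V : lmodType R).

Lemma convex_functionE (g : V -> R) (x y : V) (t : R) :
  convex_function setT g -> 0 <= t <= 1 ->
  g (t *: x + (1 - t) *: y) <= t * g x + (1 - t) * g y.
Proof.
move=> cg /andP[t0 t1].
have := cg (Itv01 t0 t1) x y; rewrite !in_setT => /(_ isT isT).
by rewrite convRE.
Qed.

Lemma convex_functionI (g : V -> R) :
  (forall x y t, 0 <= t <= 1 -> g (t *: x + (1 - t) *: y) <= t * g x + (1 - t) * g y) ->
  convex_function setT g.
Proof.
by move=> cg t x y _ _; rewrite convRE; apply: (cg x y t%:num); rewrite ge0 le1.
Qed.

Lemma convex_setE (S : set V) (x y : V) (t : R) :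
  convex_set S -> 0 <= t <= 1 -> S x -> S y -> S (t *: x + (1 - t) *: y).
Proof.
move=> cS /andP[t0 t1] Sx Sy.
by have := cS x y (Itv01 t0 t1); rewrite !inE; apply.
Qed.

(** Induction on [s], giving the head the weight [1 / k.+1]. The condition [g 0 <= 0] settles the
    empty sequence, where [0^-1 = 0] leaves [g 0] on the left. *)
Lemma jensen_mean (g : V -> R) (s : seq V) :
  convex_function setT g -> g 0 <= 0 ->
  g ((size s)%:R^-1 *: \sum_(y <- s) y) <= (size s)%:R^-1 * \sum_(y <- s) g y.
Proof.
move=> cg g0; elim: s => [|y s IHs]; first by rewrite !big_nil scaler0 mulr0.
rewrite !big_cons /=; set k := size s in IHs *; pose t : R := k.+1%:R^-1.
have k1 : k.+1%:R != 0 :> R by rewrite pnatr_eq0.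
have tk : 1 - t = t * k%:R.
  by apply: (mulfI k1); rewrite mulrBr mulr1 mulrA mulfV // mul1r mulrSr addrK.
have t0 : 0 <= t by rewrite invr_ge0.
have t1 : 0 <= 1 - t by rewrite tk mulr_ge0.
have := convex_functionE y (k%:R^-1 *: \sum_(z <- s) z) (t := t) cg.
have -> : 0 <= t <= 1 by rewrite t0 -subr_ge0 t1.
move=> /(_ isT); rewrite -/t.
case: (posnP k) => k0.
  have s0 : s = [::] by apply/size0nil.
  by rewrite tk k0 mulr0 s0 !big_nil scale0r mul0r !addr0.
have kn : k%:R != 0 :> R by rewrite pnatr_eq0 -lt0n.
rewrite scalerA tk mulfK // -scalerDr => /le_trans; apply.
by rewrite mulrDr lerD2l -mulrA ler_wpM2l // -ler_pdivlMl ?ltr0n.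
Qed.

(** According to the sign of [t], the point lies on the segment from [0] to [v] or to [- v]. *)
Lemma convex_scale_le (g : V -> R) (v : V) (t : R) :
  convex_function setT g -> g 0 <= 0 -> `|t| <= 1 ->
  g (t *: v) <= `|t| * (`|g v| + `|g (- v)|).
Proof.
move=> cg g0 t1.
have pos (s : R) (w : V) : 0 <= s <= 1 -> g (s *: w) <= s * `|g w|.
  move=> s01; have := convex_functionE w 0 cg s01.
  rewrite scaler0 addr0 => /le_trans; apply.
  case/andP: s01 => s0 s1.
  have : (1 - s) * g 0 <= 0 by rewrite mulr_ge0_le0 // subr_ge0.
  have := ler_wpM2l s0 (ler_norm (g w)); lra.
case: (leP 0 t) => t0.
  rewrite ger0_norm // in t1 *; apply: le_trans (pos _ _ _) _; first by rewrite t0.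
  by rewrite ler_wpM2l // lerDl.
rewrite ltr0_norm // in t1 *; rewrite -[t *: v]opprK -scaleNr -scalerN.
apply: le_trans (pos _ _ _) _; first by rewrite t1 oppr_ge0 ltW.
by rewrite ler_wpM2l ?lerDr // oppr_ge0 ltW.
Qed.

End Convexity.

(** Continuity of a convex function in finite dimension, along any filter. A small [h] is the mean
    of the axis vectors with coefficients [n%:R * h j 0], so Jensen bounds the increment [g h] above
    by a linear form in the [|h j 0|]; the midpoint [0] of [h] and [- h] gives the lower bound. *)
Lemma convex_cvg (R : realType) (n : nat) (f : 'cV[R]_n -> R) (T : Type)
    (F : set_system T) {FF : Filter F} (u : T -> 'cV[R]_n) (z : 'cV[R]_n) :
  convex_function setT f -> u @ F --> z -> (fun t => f (u t)) @ F --> f z.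
Proof.
move=> cf uz; pose g (h : 'cV[R]_n) := f (z + h) - f z.
have cg : convex_function setT g.
  apply: convex_functionI => x y t t01; rewrite /g.
  have := convex_functionE (z + x) (z + y) cf t01.
  have -> : t *: (z + x) + (1 - t) *: (z + y) = z + (t *: x + (1 - t) *: y).
    by rewrite !scalerDr addrACA -scalerDl subrKC scale1r.
  lra.
have g0 : g 0 = 0 by rewrite /g addr0 subrr.
pose C (j : 'I_n) := `|g (delta_mx j 0)| + `|g (- delta_mx j 0)|.
have gle (h : 'cV[R]_n) : (forall j, `|n%:R * h j 0| <= 1) -> g h <= \sum_j `|h j 0| * C j.
  move=> h1; pose s := [seq (n%:R * h j 0) *: (delta_mx j 0 : 'cV[R]_n) | j <- enum 'I_n].
  have := jensen_mean s cg; rewrite g0 lexx => /(_ isT).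
  have -> : size s = n by rewrite size_map size_enum_ord.
  have nK (a : R) (j : 'I_n) : n%:R^-1 * (n%:R * a) = a.
    by rewrite mulrA mulVf ?mul1r // pnatr_eq0; case: (n) j => [[]|].
  have -> : n%:R^-1 *: \sum_(y <- s) y = h.
    rewrite big_map -/(index_enum _) scaler_sumr [RHS]matrix_sum_delta.
    by rewrite big_enum; apply: eq_bigr => j _; rewrite big_ord1 scalerA nK.
  rewrite big_map big_enum /=.
  move=> /le_trans; apply; rewrite mulr_sumr; apply: ler_sum => j _.
  have -> : `|h j 0| * C j = n%:R^-1 * (`|n%:R * h j 0| * C j).
    by rewrite normrM normr_nat !mulrA -(mulrA _ n%:R) nK.
  by rewrite ler_wpM2l ?invr_ge0 //; apply: convex_scale_le; rewrite ?g0.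
have gN (h : 'cV[R]_n) : - g (- h) <= g h.
  have half : 0 <= (2^-1 : R) <= 1 by lra.
  have := convex_functionE h (- h) cg half.
  have -> : 1 - 2^-1 = 2^-1 :> R by lra.
  rewrite scalerN subrr g0; lra.
have coord0 (j : 'I_n) : (fun t => (u t - z) j 0) @ F --> (0 : R).
  have : (fun t => u t - z) @ F --> z - z by apply: cvgB uz (cvg_cst _).
  by rewrite subrr => /(cvg_coord (i := j) (j := 0)); rewrite mxE.
have small : \forall t \near F, forall j, `|n%:R * (u t - z) j 0| <= 1.
  apply: filter_forall => j; near=> t; apply/ltW; near: t.
  have : (fun t => n%:R * (u t - z) j 0) @ F --> (0 : R).
    by rewrite -[X in _ --> X](mulr0 (n%:R)); apply: cvgMl_tmp; exact: coord0.
  by move/cvgr0Pnorm_lt; apply.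
have : (fun t => f (u t) - f z) @ F --> (0 : R).
  apply: norm_cvg0.
  apply: (@squeeze_cvgr _ _ _ _ (fun=> 0) (fun t => \sum_j `|(u t - z) j 0| * C j)).
  - near=> t; rewrite normr_ge0 /=.
    have fE : f (u t) - f z = g (u t - z) by rewrite /g subrKC.
    have sm : forall j, `|n%:R * (u t - z) j 0| <= 1 by near: t.
    have up := gle _ sm.
    have dn : g (- (u t - z)) <= \sum_j `|(u t - z) j 0| * C j.
      rewrite (eq_bigr (fun j => `|(- (u t - z)) j 0| * C j)); last first.
        by move=> j _; rewrite [in RHS]mxE normrN.
      by apply: gle => j; rewrite mxE mulrN normrN.
    rewrite fE ler_norml up andbT; have := gN (u t - z); lra.
  - exact: cvg_cst.
  - apply: cvg_sumr0 => j _; rewrite -(mul0r (C j)); apply: cvgMr_tmp.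
    by rewrite -(normr0 R); apply: cvg_norm; exact: coord0.
have -> : (fun t => f (u t)) = (fun t => (f (u t) - f z) + f z).
  by apply/funext => t; rewrite subrK.
by move=> fz0; rewrite -[X in _ --> X](add0r (f z)); apply: cvgD fz0 (cvg_cst _).
Unshelve. all: by end_near. Qed.

(** * First-order optimality for the quadratic penalty *)

Lemma dotvE (R : realType) (m : nat) (u v : 'cV[R]_m) : dotv u v = fdot u v.
Proof. by rewrite /fdot trace_mx11. Qed.

Lemma enorm_sqr (R : realType) (m : nat) (v : 'cV[R]_m) : enorm v ^+ 2 = fdot v v.
Proof. by rewrite /enorm dotvE sqr_sqrtr // fdot_ge0. Qed.

Lemma slope_ge0 (R : realType) (a q : R) :
  (forall t, 0 < t <= 1 -> 0 <= t * a + t ^+ 2 * q) -> 0 <= a.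
Proof.
move=> h; rewrite leNgt; apply/negP => a0.
(* This choice gives [t <= 1] and [t * |q| < - a], so that [a + t * q] would be negative. *)
pose s := - a + `|q| + 1; have s0 : 0 < s by rewrite /s; have := normr_ge0 q; lra.
pose t := - a / s; have tpos : 0 < t by rewrite divr_gt0 // oppr_gt0.
have t1 : t <= 1 by rewrite ler_pdivrMr // mul1r /s; have := normr_ge0 q; lra.
have := h t; rewrite tpos t1 expr2 -mulrA -mulrDr pmulr_rge0 // => /(_ isT).
have ts : t * s = - a by rewrite /t divfK // gt_eqF.
have : t * q <= t * `|q| by rewrite ler_wpM2l ?ler_norm // ltW.
rewrite /s in ts; have : 0 < t * - a by rewrite mulr_gt0 // oppr_gt0.
rewrite !mulrDr mulr1 in ts; lra.
Qed.

(** Compare [x] with [t *: y + (1 - t) *: x] and let [t] tend to 0: convexity handles [g], and the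
    penalty contributes only its slope at [x], which is linear with multiplier
    [c *: (A *m x + a)]. *)
Lemma argmin_penalized (R : realType) (n p : nat) (g : 'cV[R]_n -> R)
    (S : set 'cV[R]_n) (A : 'M[R]_(p, n)) (l a : 'cV[R]_p) (c : R) (x : 'cV[R]_n) :
  convex_function setT g -> convex_set S ->
  argmin S (fun y => g y + dotv l (A *m y) + c / 2 * enorm (A *m y + a) ^+ 2) x ->
  argmin S (fun y => g y + dotv (l + c *: (A *m x + a)) (A *m y)) x.
Proof.
move=> cg cS [Sx xmin]; split=> // y Sy.
pose e := A *m x + a; pose h := A *m y - A *m x.
rewrite -subr_ge0; apply: (@slope_ge0 _ _ (c / 2 * fdot h h)) => t /andP[t0 t1].
have t01 : 0 <= t <= 1 by rewrite t1 ltW.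
have := xmin _ (convex_setE cS t01 Sy Sx).
have := convex_functionE y x cg t01.
have Ay : A *m y = A *m x + h by rewrite /h subrKC.
have -> : A *m (t *: y + (1 - t) *: x) = A *m x + t *: h.
  by rewrite mulmxDr -!scalemxAr Ay scalerDr addrAC -scalerDl subrKC scale1r.
have -> : A *m x + t *: h + a = e + t *: h by rewrite addrAC.
rewrite -/e Ay !enorm_sqr !dotvE; move: e h {Ay} => e h.
rewrite !(fdotDl, fdotDr, fdotZl).
rewrite (fdotC l (t *: h)) (fdotC e (t *: h)) (fdotC h (t *: h)) !fdotZl.
rewrite (fdotC h l) (fdotC h e) expr2.
lra.
Qed.

(** * Saddle points, weak and strong duality *)

Section Saddle.
Variables (R : realType) (N p : nat) (n : 'I_N -> nat).
Variables (f : forall i, 'cV[R]_(n i) -> R) (X : forall i, set 'cV[R]_(n i)).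
Variables (A : forall i, 'M[R]_(p, n i)) (b : 'cV[R]_p) (bs : 'I_N -> 'cV[R]_p).
Hypothesis bs_sum : \sum_i bs i = b.
Hypothesis f_convex : forall i, convex_function setT (f (i:=i)).
Hypothesis X_convex : forall i, convex_set (X (i:=i)).
Hypothesis X_compact : forall i, compact (X (i:=i)).

Definition lagrangian (mu : 'cV[R]_p) i (y : 'cV[R]_(n i)) : R := f y + dotv mu (A i *m y).

Definition saddle (x : forall i, 'cV[R]_(n i)) (mu : 'cV[R]_p) : Prop :=
  \sum_i A i *m x i = b /\ forall i, argmin (X (i:=i)) (lagrangian mu (i:=i)) (x i).

Lemma sum_dotv (mu : 'cV[R]_p) (v : 'I_N -> 'cV[R]_p) :
  \sum_i dotv mu (v i) = dotv mu (\sum_i v i).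
Proof. by rewrite /dotv mulmx_sumr summxE. Qed.

Lemma dual_term_argmin (mu : 'cV[R]_p) i (y : 'cV[R]_(n i)) :
  argmin (X (i:=i)) (lagrangian mu (i:=i)) y ->
  dual_term f X A bs i mu = lagrangian mu y - dotv mu (bs i).
Proof.
move=> [Xy ymin]; rewrite /dual_term.
have E z : f z + dotv mu (A i *m z - bs i) = lagrangian mu z - dotv mu (bs i).
  by rewrite /lagrangian !dotvE fdotBr addrA.
under eq_imagel => z _ do rewrite E.
apply: (inf_argmin (g := fun z => lagrangian mu z - dotv mu (bs i))).
by split=> // z /ymin; rewrite lerD2r.
Qed.

Lemma lagrangian_cvg (T : Type) (F : set_system T) {FF : Filter F} i (nu : T -> 'cV[R]_p)
    (mu : 'cV[R]_p) (u : T -> 'cV[R]_(n i)) (z : 'cV[R]_(n i)) :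
  nu @ F --> mu -> u @ F --> z -> (fun t => lagrangian (nu t) (u t)) @ F --> lagrangian mu z.
Proof.
move=> numu uz; apply: cvgD; first exact: convex_cvg uz.
rewrite dotvE; under eq_fun do rewrite dotvE.
by apply: (cvg_fdot numu); apply: cvg_mulmx uz; exact: cvg_cst.
Qed.

Lemma lagrangian_argmin_exists (mu : 'cV[R]_p) i :
  X (i:=i) !=set0 -> exists y, argmin (X (i:=i)) (lagrangian mu (i:=i)) y.
Proof.
move=> X0.
have [|y Xy ymin] := compact_EVT_min X0 (@X_compact i) (f := lagrangian mu (i:=i)).
  apply: continuous_subspaceT => z.
  have zz : (fun y : 'cV[R]_(n i) => y) @ nbhs z --> (z : 'cV[R]_(n i)) by exact: cvg_id.
  exact: (lagrangian_cvg (cvg_cst mu) zz).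
exists y; split; first by rewrite inE in Xy.
by move=> z Xz; apply: ymin; rewrite inE.
Qed.

Lemma dual_term_le (mu : 'cV[R]_p) i (y : 'cV[R]_(n i)) :
  X y -> dual_term f X A bs i mu <= lagrangian mu y - dotv mu (bs i).
Proof.
move=> Xy; have [|z zmin] := @lagrangian_argmin_exists mu i; first by exists y.
by rewrite (dual_term_argmin zmin) lerD2r; case: zmin => _; apply.
Qed.

(** Weak duality: for every [nu], evaluating the Lagrangian at the feasible [x] bounds the dual
    value by the primal value at [x], and [mu] attains this bound. *)
Lemma saddle_dual (x : forall i, 'cV[R]_(n i)) (mu : 'cV[R]_p) :
  saddle x mu -> dual_optimal f X A bs mu.
Proof.
move=> [xb xmin] nu; rewrite /dual_obj.
have dE i : dual_term f X A bs i mu = lagrangian mu (x i) - dotv mu (bs i).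
  exact: dual_term_argmin.
rewrite (eq_bigr _ (fun i _ => dE i)).
have tot nu' : \sum_i (lagrangian nu' (x i) - dotv nu' (bs i)) = \sum_i f (x i).
  by rewrite sumrB big_split /= !sum_dotv bs_sum xb addrK.
rewrite tot -(tot nu); apply: ler_sum => i _.
by apply: dual_term_le; case: (xmin i).
Qed.

Lemma saddle_primal (x z : forall i, 'cV[R]_(n i)) (mu : 'cV[R]_p) :
  saddle x mu -> primal_feasible X A b z -> primal_obj f x <= primal_obj f z.
Proof.
move=> [xb xmin] [zb Xz].
have : \sum_i lagrangian mu (x i) <= \sum_i lagrangian mu (z i).
  by apply: ler_sum => i _; case: (xmin i) => _; apply.
by rewrite !big_split /= !sum_dotv xb zb lerD2r.
Qed.

(* Minimise over the product of the [X i] the Lagrangian at the dual optimum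
   [mu] plus half the squared residual: with [r] the residual at a minimiser,
   the dual value at [mu + r] exceeds the one at [mu] by at least [|r|^2]. *)
Lemma dual_optimal_saddle (mu : 'cV[R]_p) :
  (forall i, X (i:=i) !=set0) -> dual_optimal f X A bs mu ->
  exists x, saddle x mu.
Proof.
move=> X0 mu_opt.
pose T := prod_topology (fun i => 'cV[R]_(n i)).
pose res (x : T) : 'cV[R]_p := \sum_i A i *m x i - b.
pose Phi (x : T) : R := \sum_i lagrangian mu (x i) + 1 / 2 * fdot (res x) (res x).
have Phi_cvg (F : set_system T) (FF : Filter F) (x : T) :
    (forall i, (fun w : T => w i) @ F --> x i) -> Phi @ F --> Phi x.
  move=> xc; apply: cvgD.
    by apply: cvg_sumr => i _; exact: (lagrangian_cvg (cvg_cst mu) (xc i)).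
  have rx : res @ F --> res x.
    apply: cvgB (cvg_cst _); apply: cvg_sum_mx => i.
    by apply: cvg_mulmx (xc i); exact: cvg_cst.
  by apply: cvgMl_tmp; exact: cvg_fdot.
have Kcpt : @compact T [set x : T | forall i, X (x i)] by apply: tychonoff => i.
have K0 : [set x : T | forall i, X (x i)] !=set0.
  by exists (fun i => projT1 (cid (X0 i))) => i; case: cid.
have [|x Xx xmin] := compact_EVT_min K0 Kcpt (f := Phi).
  apply: continuous_subspaceT => x.
  exact: (Phi_cvg (nbhs x) (nbhs_filter x) x (fun i => @proj_continuous _ _ i x)).
have {}Xx : forall i, X (x i) by rewrite inE in Xx.
have {}xmin (y : T) : (forall i, X (y i)) -> Phi x <= Phi y.
  by move=> Xy; apply: xmin; rewrite inE.
(* Changing block [i] alone reduces [Phi] to a penalised local objective with [c = 1]; its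
   linearisation moves the multiplier from [mu] to [mu + res x]. *)
have amin i : argmin (X (i:=i)) (lagrangian (mu + res x) (i:=i)) (x i).
  pose a := res x - A i *m x i.
  have -> : mu + res x = mu + 1 *: (A i *m x i + a) by rewrite /a subrKC scale1r.
  apply: argmin_penalized => //; split=> // y Xy.
  pose w : T := eqtype.dfwith x y.
  have wi : w i = y by rewrite /w dfwith_in.
  have wj j : j != i -> w j = x j by move=> ji; rewrite /w dfwith_out // eq_sym.
  have := xmin w; have Xw j : X (w j).
    by have [->|ji] := eqVneq j i; rewrite ?wi ?wj.
  move=> /(_ Xw); rewrite /Phi (bigD1 i) //= [X in _ <= X + _](bigD1 i) //=.
  have -> : \sum_(j | j != i) lagrangian mu (w j) = \sum_(j | j != i) lagrangian mu (x j).
    by apply: eq_bigr => j ji; rewrite wj.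
  have -> : res w = A i *m y + a.
    rewrite /a /res (bigD1 i) //= wi [in RHS](bigD1 i) //=.
    have -> : \sum_(j | j != i) A j *m w j = \sum_(j | j != i) A j *m x j.
      by apply: eq_bigr => j ji; rewrite wj.
    by rewrite -[in RHS](addrA (A i *m x i)) (addrC (A i *m x i)) addrK addrA.
  have -> : res x = A i *m x i + a by rewrite /a subrKC.
  rewrite wi !enorm_sqr /lagrangian; lra.
have r0 : res x = 0.
  have := mu_opt (mu + res x); rewrite /dual_obj.
  rewrite (eq_bigr _ (fun i _ => dual_term_argmin (amin i))).
  have le i : dual_term f X A bs i mu <= lagrangian mu (x i) - dotv mu (bs i).
    exact: dual_term_le.
  move=> /le_trans/(_ (ler_sum _ (fun i _ => le i))).
  rewrite !sumrB /lagrangian !big_split /= !sum_dotv bs_sum !dotvE !(fdotDl mu (res x)).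
  have -> : fdot (res x) (\sum_i A i *m x i) = fdot (res x) (res x) + fdot (res x) b.
    by rewrite -fdotDr subrK.
  move=> r2; have {}r2 : fdot (res x) (res x) <= 0 by lra.
  apply/matrixP => i j; rewrite [RHS]mxE; apply/eqP; rewrite -sqrf_eq0 eq_le sqr_ge0 andbT.
  exact: le_trans (fdot_coord _ _ _) r2.
exists x; split; first by apply/eqP; rewrite -subr_eq0 -/(res x) r0.
by move=> i; have := amin i; rewrite r0 addr0.
Qed.

End Saddle.

(** * Subsequential limits through filters; bounded sets of matrices *)

(** The filter is generated by the tails of [\oo] and the preimages under [u] of neighbourhoods of
    [z]; the cluster property says that none of its members is empty. *)
Lemma cluster_seq_filter (T : topologicalType) (u : nat -> T) (z : T) :
  cluster (u @ \oo) z ->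
  exists2 F : set_system nat, ProperFilter F /\ F --> \oo & u @ F --> z.
Proof.
move=> uz.
pose F := [set S : set nat | exists2 B, nbhs z B & \forall k \near \oo, B (u k) -> S k].
have FF : Filter F.
  split.
  - by exists setT; [exact: filterT | exact: nearW].
  - move=> S S' [B zB BS] [B' zB' BS']; exists (B `&` B'); first exact: filterI.
    by apply: filterS2 BS BS' => k BSk BSk' [/BSk Sk /BSk' S'k].
  - by move=> S S' SS' [B zB BS]; exists B => //; apply: filterS BS => k BSk /BSk/SS'.
exists F; last first.
  by move=> B zB; exists B => //; exact: nearW.
split; last by move=> S Soo; exists setT; [exact: filterT | apply: filterS Soo].
apply: Build_ProperFilter_ex => // S [B zB BS].
have [//|nS] := pselect (exists k, S k); exfalso.
have nB : (u @ \oo) (~` B) by apply: filterS BS => k BSk Bk; apply: nS; exists k; exact: BSk.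
by have [y [nBy By]] := uz _ _ nB zB.
Qed.

Lemma compact_fdot_ball (R : realType) (m n : nat) (M : R) :
  exists2 K : set 'M[R]_(m, n), compact K & forall V, fdot V V <= M -> K V.
Proof.
pose S := [set v : 'rV[R]_(m * n) | forall i, v 0 i \in `[- (1 + M), 1 + M]].
have cS : compact S.
  by apply: (@rV_compact _ _ (fun=> `[- (1 + M), 1 + M]%classic)) => _; exact: segment_compact.
exists [set vec_mx v | v in S].
  apply: continuous_compact cS; apply: continuous_subspaceT => v.
  apply: (@cvg_mx _ _ (nbhs v) (nbhs_filter v)) => i j; rewrite mxE.
  under eq_fun do rewrite mxE.
  exact: coord_continuous.
move=> V VM; exists (mxvec V); last exact: mxvecK.
move=> k; case/mxvec_indexP: k => i j; rewrite mxvecE in_itv /=.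
rewrite -ler_norml; have := fdot_coord V i j.
rewrite -real_normK ?num_real // => h.
have := sqr_ge0 (`|V i j| - 1); have := normr_ge0 (V i j); nra.
Qed.

(** * Agents as the columns of one matrix *)

Section Stack.
Variables (R : realType) (N p : nat).
Implicit Types u v : 'I_N -> 'cV[R]_p.

(** With agents as columns, mixing is right multiplication by [W]. *)
Definition stack v : 'M[R]_(p, N) := \matrix_(a, i) v i a 0.

Lemma stackB u v : stack u - stack v = stack (fun i => u i - v i).
Proof. by apply/matrixP => a i; rewrite !mxE. Qed.

Lemma stackD u v : stack u + stack v = stack (fun i => u i + v i).
Proof. by apply/matrixP => a i; rewrite !mxE. Qed.

Lemma stackZ (c : R) v : c *: stack v = stack (fun i => c *: v i).
Proof. by apply/matrixP => a i; rewrite !mxE. Qed.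

Lemma fdot_stack u v : fdot (stack u) (stack v) = \sum_i fdot (u i) (v i).
Proof.
rewrite fdotE; apply: eq_bigr => i _; rewrite fdotE big_ord1.
by apply: eq_bigr => a _; rewrite !mxE.
Qed.

Lemma stack_mix (E : rel 'I_N) (W : 'M[R]_N) v :
  W^T = W -> (forall i j, ~~ E i j -> W i j = 0) ->
  stack (mix E W v) = stack v *m W.
Proof.
move=> WT Wsupp; apply/matrixP => a i; rewrite !mxE summxE big_mkcond /=.
apply: eq_bigr => j _; rewrite !mxE -[in RHS]WT mxE mulrC.
by case: ifPn => [_|/Wsupp ->]; rewrite ?mulr0.
Qed.

Lemma stack_sum v : stack v *m const_mx 1 = \sum_i v i.
Proof.
apply/matrixP => a j; rewrite mxE summxE (ord1 j).
by apply: eq_bigr => i _; rewrite !mxE mulr1.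
Qed.

Lemma stack_avg v : stack v *m avg_mx R N = stack (fun=> N%:R^-1 *: \sum_i v i).
Proof.
apply/matrixP => a j; rewrite !mxE summxE mulrC mulr_suml.
by apply: eq_bigr => i _; rewrite !mxE.
Qed.

Lemma psdmx_fdot (W : 'M[R]_N) : psdmx W ->
  forall V : 'M[R]_(p, N), 0 <= fdot V (V *m W).
Proof.
move=> [WT W0] V; rewrite fdotE exchange_big; apply: sumr_ge0 => a _.
have := W0 (row a V)^T; rewrite dotvE fdotE big_ord1.
rewrite -{1}WT -trmx_mul => /le_trans; apply; rewrite le_eqVlt; apply/orP; left.
by apply/eqP/eq_bigr => j _; rewrite -row_mul !mxE.
Qed.

End Stack.

(** * Runs of the algorithm as instances of the tracking recursion *)

Section Run.
Variables (R : realType) (N p : nat) (n : 'I_N -> nat).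
Variables (f : forall i, 'cV[R]_(n i) -> R) (X : forall i, set 'cV[R]_(n i)).
Variables (A : forall i, 'M[R]_(p, n i)) (b : 'cV[R]_p) (bs : 'I_N -> 'cV[R]_p).
Hypothesis bs_sum : \sum_i bs i = b.
Hypothesis f_convex : forall i, convex_function setT (f (i:=i)).
Hypothesis X_convex : forall i, convex_set (X (i:=i)).
Hypothesis X_compact : forall i, compact (X (i:=i)).
Variables (E : rel 'I_N) (W : 'M[R]_N) (c : R).
Hypothesis c_gt0 : 0 < c.
Hypothesis W_support : forall i j, ~~ E i j -> W i j = 0.
Hypothesis WT : W^T = W.
Hypothesis W_ge0 : forall i j, 0 <= W i j.
Hypothesis W_row : forall i, \sum_j W i j = 1.
Hypothesis W_gt0 : forall i j, E i j -> 0 < W i j.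
Hypothesis E_connected : forall i j, connect E i j.
Hypothesis W_psd : psdmx W.
Variables (x : nat -> forall i, 'cV[R]_(n i)) (d lam : nat -> 'I_N -> 'cV[R]_p).
Hypothesis run : tracking_admm f X A bs E W c x d lam.

Let Lam k := stack (lam k).

Lemma run_feasible k i : X (x k i).
Proof. by case: k => [|k]; [exact: (admm_x0 run) | case: (admm_xS run k i)]. Qed.

(** The slope of the penalty at the new point turns the mixed multiplier into the updated one:
    [l + c *: d k.+1 i] is [lam k.+1 i]. *)
Lemma run_argmin k i :
  argmin (X (i:=i)) (lagrangian f A (lam k.+1 i) (i:=i)) (x k.+1 i).
Proof.
pose l := mix E W (lam k) i; pose a := - (A i *m x k i) + mix E W (d k) i.
have xmin : argmin (X (i:=i)) (fun y => f y + dotv l (A i *m y)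
    + c / 2 * enorm (A i *m y + a) ^+ 2) (x k.+1 i).
  by have [Xx xm] := admm_xS run k i; split=> // y /xm; rewrite /a !addrA.
have := argmin_penalized (@f_convex i) (@X_convex i) xmin.
suff -> : l + c *: (A i *m x k.+1 i + a) = lam k.+1 i by [].
rewrite (admm_lamS run) (admm_dS run) -/l /a; congr (_ + _ *: _).
by rewrite addrA addrC addrA.
Qed.

(** The reference saddle point is a parameter, so that it can later be exchanged for a limit point
    of the run itself. *)
Lemma saddle_limits (xs : forall i, 'cV[R]_(n i)) (mu : 'cV[R]_p)
    (U := fun k => stack (fun i => A i *m x k i - A i *m xs i)) :
  saddle f X A b xs mu ->
  [/\ exists M, forall k, fdot (Lam k) (Lam k) <= M,
      (fun k => Lam k *m (1%:M - avg_mx R N)) @ \oo --> (0 : 'M[R]_(p, N)),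
      (fun k => U k *m avg_mx R N) @ \oo --> (0 : 'M[R]_(p, N)) &
      forall F : set_system nat, ProperFilter F -> F --> \oo ->
        (forall i, (fun k => x k i) @ F --> xs i) ->
        Lam @ F --> stack (fun=> mu) -> Lam @ \oo --> stack (fun=> mu)].
Proof.
move=> [xsb xsmin].
have c0 : c != 0 by rewrite gt_eqF.
pose Mu : 'M[R]_(p, N) := stack (fun=> mu).
have MuW : Mu *m W = Mu.
  apply/matrixP => a i; rewrite mxE.
  rewrite (eq_bigr (fun j => mu a 0 * W i j)).
    by rewrite -mulr_sumr W_row mulr1 mxE.
  by move=> j _; rewrite mxE -{1}WT mxE.
(* Dividing by [c] normalises the multiplier update to [l k *m W + D k.+1]. *)
pose l k := c^-1 *: (Lam k - Mu).
have LamE k : Lam k = c *: l k + Mu by rewrite scalerA mulfV // scale1r subrK.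
pose D k := stack (d k).
have D_step k : D k.+1 = D k *m W + U k.+1 - U k.
  rewrite -(stack_mix _ WT W_support) stackD stackB; congr stack.
  apply/funext => i; rewrite (admm_dS run) -!addrA; congr (_ + _).
  by rewrite opprB addKr.
have l_step k : l k.+1 = l k *m W + D k.+1.
  rewrite /l -scalemxAl mulmxBl MuW -(stack_mix _ WT W_support).
  have -> : D k.+1 = c^-1 *: (c *: D k.+1) by rewrite scalerA mulVf // scale1r.
  rewrite -scalerDr; congr (_ *: _); rewrite addrAC; congr (_ - _).
  by rewrite stackZ stackD; congr stack; apply/funext => i; rewrite (admm_lamS run).
have D_avg : D 0%N *m avg_mx R N = U 0%N *m avg_mx R N.
  rewrite !stack_avg !sumrB xsb; congr stack; apply/funext => _; congr (_ *: _).
  under eq_bigr do rewrite (admm_d0 run).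
  by rewrite sumrB bs_sum.
(* Add the minimality of [x k.+1 i] for [lam k.+1 i], tested at [xs i], to that of [xs i] for [mu],
   tested at [x k.+1 i]: the values of [f] cancel. *)
have monotone k : fdot (l k.+1) (U k.+1) <= 0.
  rewrite fdotZl pmulr_rle0 ?invr_gt0 // stackB fdot_stack; apply: sumr_le0 => i _.
  have [Xx xmin] := run_argmin k i; have [Xxs xsm] := xsmin i.
  have := xmin _ Xxs; have := xsm _ Xx.
  rewrite /lagrangian !dotvE !(fdotBl, fdotBr); lra.
have [[M lM] lavg Uavg lcvg] :=
  tracking_convergence WT W_ge0 W_row W_gt0 E_connected (psdmx_fdot W_psd)
    D_step l_step D_avg monotone.
split; [| | exact: Uavg |].
- exists (2 * c ^+ 2 * M + 2 * fdot Mu Mu) => k.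
  have := lM k; rewrite LamE; move: (l k) (Mu) => v m /(ler_wpM2l (sqr_ge0 c)).
  have := fdot_ge0 (c *: v - m).
  rewrite !(fdotBl, fdotBr, fdotDl, fdotDr) (fdotC m) !fdotZl (fdotC _ (c *: v)) fdotZl.
  rewrite expr2; lra.
- have MuA : Mu *m (1%:M - avg_mx R N) = 0.
    have [B _ BE] := laplacian_pinv WT W_ge0 W_row W_gt0 E_connected.
    by rewrite -BE mulmxA mulmxBr mulmx1 MuW subrr mul0mx.
  rewrite (_ : (fun k => _) = fun k => c *: (l k *m (1%:M - avg_mx R N))).
    by rewrite -[X in _ --> X](scaler0 _ c); apply: cvgZl_tmp.
  by apply/funext => k; rewrite LamE mulmxDl MuA addr0 scalemxAl.
move=> F FF Foo xF LF.
have LamF (G : set_system nat) : Filter G -> l @ G --> (0 : 'M[R]_(p, N)) -> Lam @ G --> Mu.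
  move=> FG lG; rewrite (funext LamE) -[X in _ --> X]add0r; apply: cvgD (cvg_cst _).
  by rewrite -[X in _ --> X](scaler0 _ c); apply: cvgZl_tmp.
apply: LamF; apply: (lcvg F FF Foo).
- apply: cvg_mx => a i; rewrite mxE; under eq_fun do rewrite mxE.
  have : (fun k => A i *m x k i - A i *m xs i) @ F --> A i *m xs i - A i *m xs i.
    by apply: cvgB (cvg_cst _); apply: cvg_mulmx (xF i); exact: cvg_cst.
  by rewrite subrr => /(cvg_coord (i := a) (j := 0)); rewrite mxE.
- rewrite -[X in _ --> X](scaler0 _ c^-1); apply: cvgZl_tmp.
  by rewrite -(subrr Mu); apply: cvgB LF (cvg_cst _).
Qed.

Lemma cvg_oo (F : set_system nat) (V : topologicalType) (u : nat -> V) (a : V) :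
  F --> \oo -> u @ \oo --> a -> u @ F --> a.
Proof. by move=> Foo; apply: cvg_trans; exact: cvg_app. Qed.

(** Feasibility follows from the vanishing average of [U]. For optimality, minimality of the
    iterates against [xs] bounds their objective by [primal_obj f xs - fdot (Lam k) (U k)], and the
    pairing vanishes along [F]. *)
Lemma limit_optimal (xs z : forall i, 'cV[R]_(n i)) (mu : 'cV[R]_p)
    (F : set_system nat) :
  saddle f X A b xs mu -> ProperFilter F -> F --> \oo ->
  (forall i, (fun k => x k i) @ F --> z i) ->
  primal_optimal f X A b z.
Proof.
move=> sad FF Foo xz.
have [[M LM] Lavg Uavg _] := saddle_limits sad.
have [xsb xsmin] := sad.
pose U k := stack (fun i => A i *m x k i - A i *m xs i).
have AxF i : (fun k => A i *m x k i) @ F --> A i *m z i.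
  by apply: cvg_mulmx (xz i); exact: cvg_cst.
have Xz i : X (z i).
  apply: (closed_cvg _ (compact_closed (@norm_hausdorff _ _) (@X_compact i)) _ _ (xz i)).
  by apply: nearW => k; exact: run_feasible.
have zb : \sum_i A i *m z i = b.
  have ones (V : 'M[R]_(p, N)) : V *m avg_mx R N *m const_mx 1 = V *m const_mx 1 :> 'cV_p.
    by rewrite -mulmxA avg_mxE // => *; rewrite !mxE.
  have : (fun k => U k *m avg_mx R N *m (const_mx 1 : 'cV_N)) @ F
      --> (0 *m (const_mx 1 : 'cV_N) : 'cV[R]_p).
    by apply: cvg_mulmx (cvg_cst _); exact: cvg_oo.
  under eq_fun do rewrite ones stack_sum sumrB xsb; rewrite mul0mx => sum0.
  have sumz : (fun k => \sum_i A i *m x k i - b) @ F --> \sum_i A i *m z i - b.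
    exact: (cvgB (cvg_sum_mx AxF) (cvg_cst b)).
  by apply/eqP; rewrite -subr_eq0 (cvg_unique (@norm_hausdorff _ _) sumz sum0).
have UF : U @ F --> stack (fun i => A i *m z i - A i *m xs i).
  apply: cvg_mx => a i; rewrite mxE; under eq_fun do rewrite mxE.
  by apply: cvg_coord; apply: cvgB (AxF i) (cvg_cst _).
(* Split [Lam k] into disagreement and average: in each resulting pairing one factor vanishes while
   the other converges or stays bounded. *)
have LU : (fun k => fdot (Lam k) (U k)) @ F --> (0 : R).
  have E1 k : fdot (Lam k) (U k)
      = fdot (Lam k *m (1%:M - avg_mx R N)) (U k) + fdot (Lam k) (U k *m avg_mx R N).
    rewrite mulmxBr mulmx1 fdotBl (fdot_symr _ _ (trmx_avg R N)); ring.
  rewrite (funext E1) -[X in _ --> X]addr0; apply: cvgD; last first.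
    exact: (cvg_fdot_bounded LM (cvg_oo Foo Uavg)).
  have -> : 0 = fdot 0 (stack (fun i => A i *m z i - A i *m xs i)) :> R.
    by rewrite /fdot trmx0 mul0mx linear0.
  by apply: cvg_fdot UF; exact: cvg_oo.
split=> // y yfeas; apply: le_trans (saddle_primal sad yfeas).
have objF : (fun k => primal_obj f (x k)) @ F --> primal_obj f z.
  by apply: cvg_sumr => i _; exact: convex_cvg (xz i).
have bndF : (fun k => primal_obj f xs - fdot (Lam k) (U k)) @ F --> primal_obj f xs.
  by rewrite -[X in _ --> X]subr0; apply: cvgB LU; exact: cvg_cst.
apply: (ler_cvg_to objF bndF); apply: Foo.
(* Index 0 is skipped: the starting point is arbitrary and need not minimise a Lagrangian. *)
exists 1%N => // -[//|k] _ /=.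
have : \sum_i lagrangian f A (lam k.+1 i) (x k.+1 i)
    <= \sum_i lagrangian f A (lam k.+1 i) (xs i).
  by apply: ler_sum => i _; case: (run_argmin k i) => _; apply; case: (xsmin i).
rewrite /Lam /U fdot_stack !big_split /= => le1.
have -> : \sum_i fdot (lam k.+1 i) (A i *m x k.+1 i - A i *m xs i)
    = \sum_i dotv (lam k.+1 i) (A i *m x k.+1 i) - \sum_i dotv (lam k.+1 i) (A i *m xs i).
  by rewrite -sumrB; apply: eq_bigr => i _; rewrite fdotBr !dotvE.
by rewrite /primal_obj; lra.
Qed.

(** By compactness the iterates and multipliers have a joint cluster point. It is itself a saddle
    point, and taking it as the reference in [saddle_limits] forces the whole multiplier sequence to
    converge to it. *)
Lemma multipliers_converge (xs : forall i, 'cV[R]_(n i)) (mu : 'cV[R]_p) :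
  saddle f X A b xs mu ->
  exists2 lamstar, dual_optimal f X A bs lamstar &
    forall i, (fun k => lam k i) @ \oo --> lamstar.
Proof.
move=> sad; have [[M LM] Lavg _ _] := saddle_limits sad.
have [K Kcpt KM] := compact_fdot_ball p N M.
pose T := prod_topology (fun i => 'cV[R]_(n i)).
have Tcpt : @compact T [set w : T | forall i, X (w i)] by apply: tychonoff => i.
pose w k : T * 'M[R]_(p, N) := (x k : T, Lam k).
have wK : (w @ \oo) ([set v : T | forall i, X (v i)] `*` K).
  by exists 0%N => // k _; split; [move=> i; exact: run_feasible | apply: KM; exact: LM].
have [[z L] [[Xz KL] zL]] := compact_setX Tcpt Kcpt (fmap_proper_filter w _) wK.
have [F [FF Foo] wF] := cluster_seq_filter zL.
have xF i : (fun k => x k i) @ F --> z i.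
  apply: (cvg_comp w (fun q : T * 'M[R]_(p, N) => q.1 i) wF).
  apply: (cvg_comp fst (fun q : T => q i)); first exact: cvg_fst.
  exact: proj_continuous.
have LF : Lam @ F --> L by apply: (cvg_comp w snd wF); exact: cvg_snd.
have [[zb _] _] := limit_optimal sad FF Foo xF.
have Lc : L *m (1%:M - avg_mx R N) = 0.
  apply: (cvg_unique (@norm_hausdorff _ _) (F := (fun k => Lam k *m (1%:M - avg_mx R N)) @ F)).
    by apply: cvg_mulmx LF (cvg_cst _).
  exact: cvg_oo.
(* The average of the columns of [L], which all coincide because disagreement vanishes in the
   limit. *)
pose nu : 'cV[R]_p := L *m const_mx N%:R^-1.
have LE : L = stack (fun=> nu).
  apply/eqP; rewrite -[X in X == _]mulmx1 -[1%:M](subrK (avg_mx R N)) mulmxDr Lc add0r.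
  by apply/eqP/matrixP => a i; rewrite !mxE; apply: eq_bigr => j _; rewrite !mxE.
have lamF i : (fun k => lam k i) @ F --> nu.
  apply: cvg_mx => a j; rewrite (ord1 j).
  have -> : nu a 0 = L a i by rewrite [in RHS]LE [RHS]mxE.
  have -> : (fun k => lam k i a 0) = fun k => Lam k a i by apply/funext => k; rewrite mxE.
  exact: cvg_coord.
have sadz : saddle f X A b z nu.
  split=> // i; split=> // y Xy.
  apply: (ler_cvg_to (lagrangian_cvg f_convex (lamF i) (xF i))
    (lagrangian_cvg f_convex (lamF i) (cvg_cst y))).
  apply: Foo; exists 1%N => // -[//|k] _ /=.
  by case: (run_argmin k i) => _; apply.
exists nu; first exact: (saddle_dual bs_sum f_convex X_compact sadz).
have [_ _ _ /(_ F FF Foo xF)] := saddle_limits sadz; rewrite -LE => /(_ LF) Loo i.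
apply: cvg_mx => a j; rewrite (ord1 j).
have -> : nu a 0 = L a i by rewrite [in RHS]LE [RHS]mxE.
have -> : (fun k => lam k i a 0) = fun k => Lam k a i by apply/funext => k; rewrite mxE.
exact: cvg_coord.
Qed.

End Run.

(** * Optimality of limit points and convergence of the multipliers to one dual optimum *)

Unset Implicit Arguments.

Theorem theorem2 (R : realType) (N p : nat) (n : 'I_N -> nat)
    (f : forall i : 'I_N, 'cV[R]_(n i) -> R)
    (X : forall i : 'I_N, set 'cV[R]_(n i))
    (A : forall i : 'I_N, 'M[R]_(p, n i))
    (b : 'cV[R]_p) (bs : 'I_N -> 'cV[R]_p) (hb : \sum_i bs i = b)
    (E : rel 'I_N) (W : 'M[R]_N) (c : R) (hc : 0 < c)
    (hloops : forall i, E i i)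
    (hsupport : forall i j, ~~ E i j -> W i j = 0)
    (hf : forall i, convex_function setT (f i))
    (hXconvex : forall i, convex_set (X i))
    (hXcompact : forall i, compact (X i))
    (hprimal : exists x, primal_optimal f X A b x)
    (hdual : exists mu, dual_optimal f X A bs mu)
    (hundirected : forall i j, E i j <-> E j i)
    (hconnected : forall i j, connect E i j)
    (hW01 : forall i j, 0 <= W i j < 1)
    (hWsym : forall i j, W i j = W j i)
    (hWcol : forall j, \sum_i W i j = 1)
    (hWrow : forall i, \sum_j W i j = 1)
    (hWpos : forall i j, 0 < W i j <-> E i j)
    (hWpsd : psdmx W)
    (x : nat -> forall i : 'I_N, 'cV[R]_(n i))
    (d lam : nat -> 'I_N -> 'cV[R]_p)
    (hrun : tracking_admm f X A bs E W c x d lam) :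
  (forall z : forall i : 'I_N, 'cV[R]_(n i),
     cluster ((fun k => \mxcol_i x k i) @ \oo) (\mxcol_i z i) ->
     primal_optimal f X A b z) /\
  (exists2 lamstar : 'cV[R]_p,
     dual_optimal f X A bs lamstar &
     forall i : 'I_N, (fun k => lam k i) @ \oo --> lamstar).
Proof.
have [mu mu_opt] := hdual.
have X0 i : X i !=set0 by exists (x 0%N i); exact: (admm_x0 hrun).
(* The initial points show that the sets [X i] are nonempty; a dual optimum then yields a first
   reference saddle point. *)
have [xs sad] := dual_optimal_saddle hb hf hXconvex hXcompact X0 mu_opt.
have WT : W^T = W by case: hWpsd.
have W_ge0 i j : 0 <= W i j by case/andP: (hW01 i j).
have W_gt0 i j : E i j -> 0 < W i j by move/hWpos.
split=> [z /cluster_seq_filter[F [FF Foo] xF]|].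
  apply: (limit_optimal hb hf hXconvex hXcompact hc hsupport WT W_ge0 hWrow
    W_gt0 hconnected hWpsd hrun sad FF Foo) => i.
  apply: cvg_mx => a j.
  (* Each entry of a block is an entry of the stacked column, so limits of the stack give limits of
     the blocks. *)
  have colE (v : forall i, 'cV[R]_(n i)) : v i a j = (\mxcol_i v i) (tagnat.Rank i a) j.
    by rewrite -[in LHS](mxcolK v i) mxE.
  by rewrite colE; under eq_fun do rewrite colE; exact: cvg_coord.
exact: (multipliers_converge hb hf hXconvex hXcompact hc hsupport WT W_ge0 hWrow
  W_gt0 hconnected hWpsd hrun sad).
Qed.
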